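(* Let $R$ be an integral domain. The following assertions are equivalent: (i) $I_t = \widehat{I}$ for each nonzero ideal $I$ of $R$; (i') $I_t = \widehat{I}$ for each nonzero finitely generated ideal $I$ of $R$; (ii) $R$ has the finite $t$-basic ideal property; (iii) $R$ has the finite $v$-basic ideal property.
   Context: All rings are commutative with identity. For an integral domain $R$ with quotient field $F$ and a nonzero fractional ideal $I$ of $R$, put $I^{-1} := \{x \in F : xI \subseteq R\}$, $I_v := (I^{-1})^{-1}$, and $I_t := \bigcup J_v$, where $J$ ranges over the nonzero finitely generated $R$-submodules of $I$. Let $\star$ be $v$ or $t$. For nonzero ideals $J \subseteq I$ of $R$, $J$ is a $\star$-reduction of $I$ if $(JI^{n})_\star = (I^{n+1})_\star$ for some integer $n \ge 0$; it is a trivial $\star$-reduction of $I$ if $J_\star = I_\star$. A nonzero ideal $I$ is $\star$-basic if every $\star$-reduction of $I$ is trivial. The domain $R$ has the finite $\star$-basic ideal property if every nonzero finitely generated ideal of $R$ is $\star$-basic. For a nonzero ideal $I$ of $R$, $\widehat{I} := \{x \in R : I \text{ is a } t\text{-reduction of } (I,x)\}$, where $(I,x) = I + xR$ (a priori $\widehat{I}$ is only a subset of $R$). *)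

(* Defs.v *)
From HB Require Import structures.
From mathcomp Require Import all_boot all_order all_algebra.
From mathcomp Require Import fraction boolp classical_sets.

Set Implicit Arguments.
Unset Strict Implicit.
Unset Printing Implicit Defensive.

Import GRing.Theory.

Local Open Scope classical_set_scope.
Local Open Scope ring_scope.

(* MathComp's [idealr] consists of decidable proper ideals only; here ideals are
   arbitrary sets, and the whole ring is an ideal. *)
Definition is_ideal (R : idomainType) (I : set R) : Prop :=
  [/\ I 0, (forall x y, I x -> I y -> I (x + y))
    & (forall r x, I x -> I (r * x))].

Definition nonzero_ideal (R : idomainType) (I : set R) : Prop :=
  is_ideal I /\ (exists2 x, I x & x != 0).

Definition ideal_span (R : idomainType) (s : seq R) : set R :=
  [set x | exists r : 'I_(size s) -> R, x = \sum_i r i * s`_i].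

Definition fg_ideal (R : idomainType) (I : set R) : Prop :=
  exists s : seq R, I = ideal_span s.

Definition ideal_mul (R : idomainType) (I J : set R) : set R :=
  [set x | exists n (a b : 'I_n -> R),
     [/\ (forall i, I (a i)), (forall i, J (b i)) & x = \sum_i a i * b i]].

Definition ideal_exp (R : idomainType) (I : set R) (n : nat) : set R :=
  iter n (ideal_mul I) [set: R].

Definition ideal_adjoin (R : idomainType) (I : set R) (x : R) : set R :=
  [set y | exists2 a, I a & exists r, y = a + x * r].

Definition in_frac (R : idomainType) (I : set R) : set {fraction R} :=
  [set tofrac x | x in I].

Definition frac_span (R : idomainType) (s : seq {fraction R}) :
    set {fraction R} :=
  [set x | exists r : 'I_(size s) -> R, x = \sum_i tofrac (r i) * s`_i].

Definition frac_inv (R : idomainType) (I : set {fraction R}) :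
    set {fraction R} :=
  [set x | forall y, I y -> in_frac [set: R] (x * y)].

Definition v_op (R : idomainType) (I : set {fraction R}) : set {fraction R} :=
  frac_inv (frac_inv I).

(* A finitely generated R-submodule of I is [frac_span s] for some s. *)
Definition t_op (R : idomainType) (I : set {fraction R}) : set {fraction R} :=
  [set x | exists s : seq {fraction R},
     [/\ frac_span s `<=` I, (exists2 y, frac_span s y & y != 0)
       & v_op (frac_span s) x]].

Definition star_reduction (R : idomainType)
    (star : set {fraction R} -> set {fraction R}) (J I : set R) : Prop :=
  [/\ nonzero_ideal J, nonzero_ideal I, J `<=` I
    & exists n : nat, star (in_frac (ideal_mul J (ideal_exp I n)))
                      = star (in_frac (ideal_exp I n.+1))].

Definition trivial_star_reduction (R : idomainType)
    (star : set {fraction R} -> set {fraction R}) (J I : set R) : Prop :=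
  star_reduction star J I /\ star (in_frac J) = star (in_frac I).

Definition star_basic (R : idomainType)
    (star : set {fraction R} -> set {fraction R}) (I : set R) : Prop :=
  forall J, star_reduction star J I -> trivial_star_reduction star J I.

Definition finite_star_basic_property (R : idomainType)
    (star : set {fraction R} -> set {fraction R}) : Prop :=
  forall I : set R, nonzero_ideal I -> fg_ideal I -> star_basic star I.

Definition t_hat (R : idomainType) (I : set R) : set R :=
  [set x | star_reduction (@t_op R) I (ideal_adjoin I x)].

(* Main.v *)
Require Import Defs.
From mathcomp Require Import all_boot all_order all_algebra.
From mathcomp Require Import fraction boolp classical_sets ring.

(* The v-closure of a set of fractions depends only on its inverse, so reductions
   can be tested on products of generators, with [A] below [B] in the preorder
   [vle] when [B^-1] is contained in [A^-1], i.e. [A] is contained in [B_v].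
   (i') => (ii): a t-reduction of a finitely generated [I] contains a finitely
   generated one [K]; adding the generators of [I] to [K] one at a time, the last
   one lies in the t-closure of the previous stage, so it can be dropped, and
   descending reaches [K].
   (ii) => (iii): if [J] is a v-reduction of [I] and [z J] is contained in [R],
   then [z^-1] is a v-reduction of [I + (z^-1)]; up to scaling, both are finitely
   generated ideals, where t = v, so [z I] is contained in [R].
   (iii) => (i): if [I] is a t-reduction of [(I, x)], finitely many elements of
   [I] already witness that [x^(n+1)] is in [(I (I, x)^n)_t], and they generate a
   v-reduction of the ideal obtained by adjoining [x]. *)

Set Implicit Arguments.
Unset Strict Implicit.
Unset Printing Implicit Defensive.

Import GRing.Theory.

Local Open Scope classical_set_scope.
Local Open Scope ring_scope.

(** With [c] a power of [p], this splits a product into [p / q * j], which is in the ring when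
    [p / q] carries [j] into it, and a factor on which [y] can be tested. *)
Lemma mul_rearrange (K : fieldType) (q p y c j u : K) : q != 0 ->
  y * (p * c) * (j * u) = (p / q * j) * (y * (q * (c * u))).
Proof. by move=> q0; field. Qed.

(** * Products of sets of fractions and the v-preorder *)

Section FractionSets.
Variable R : idomainType.
Notation F := {fraction R}.
Implicit Types (A B C : set F) (I J : set R) (s k l : seq R).

(** No sums are taken: a set and the submodule it spans have the same inverse, so bare products
    suffice for v-closures. *)
Definition pmul A B : set F := [set a * b | a in A & b in B].
Definition pow A n : set F := iter n (pmul A) [set 1].

Definition vle A B : Prop := frac_inv B `<=` frac_inv A.

(** One half of the equality defining a v-reduction; the other half, [pmul A (pow B n)] below
    [pow B n.+1], is automatic when [A] is below [B]. *)
Definition vred A B n : Prop := vle (pow B n.+1) (pmul A (pow B n)).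

Lemma in_frac0 : in_frac [set: R] 0.
Proof. by exists 0; rewrite ?tofrac0. Qed.

Lemma in_fracD (x y : F) :
  in_frac [set: R] x -> in_frac [set: R] y -> in_frac [set: R] (x + y).
Proof. by move=> [a _ <-] [b _ <-]; exists (a + b); rewrite ?tofracD. Qed.

Lemma in_fracM (x y : F) :
  in_frac [set: R] x -> in_frac [set: R] y -> in_frac [set: R] (x * y).
Proof. by move=> [a _ <-] [b _ <-]; exists (a * b); rewrite ?tofracM. Qed.

Lemma tofrac_in_frac (r : R) : in_frac [set: R] (tofrac r).
Proof. by exists r. Qed.

Lemma vle_refl A : vle A A.
Proof. by []. Qed.

Lemma vle_trans B A C : vle A B -> vle B C -> vle A C.
Proof. by move=> AB BC x /BC /AB. Qed.

Lemma sub_vle A B : A `<=` B -> vle A B.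
Proof. by move=> AB x xB y /AB /xB. Qed.

Lemma vleU A B C : vle A C -> vle B C -> vle (A `|` B) C.
Proof. by move=> AC BC x xC y [/AC|/BC]; apply. Qed.

(** Both sides say that the product of an element of [A] with one of [frac_inv B] is always in the
    ring. *)
Lemma vleP A B : vle A B <-> A `<=` v_op B.
Proof.
split=> [AB a Aa y yB|AB x xB a /AB aB].
  by rewrite mulrC; apply: (AB _ yB).
by rewrite mulrC; apply: aB.
Qed.

Lemma vle1P x A : vle [set x] A <-> v_op A x.
Proof. by rewrite vleP sub1set inE. Qed.

Lemma vle_bigcup A B : (forall x, A x -> vle [set x] B) -> vle A B.
Proof. by move=> AB; apply/vleP => x /AB /vle1P. Qed.

Lemma v_op_eqP A B : v_op A = v_op B <-> vle A B /\ vle B A.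
Proof.
split=> [AB|[AB BA]].
  by split; apply/vleP; [rewrite -AB|rewrite AB]; apply/vleP.
by congr frac_inv; apply/seteqP; split.
Qed.

(** Multiplying into the ring is a condition stable under linear combinations, which is what lets
    generators stand for the module they span. *)
Lemma vle1_sum A n (r : 'I_n -> R) (x : 'I_n -> F) :
  (forall i, vle [set x i] A) -> vle [set \sum_i tofrac (r i) * x i] A.
Proof.
move=> xA; apply/vle1P => y yA; rewrite mulr_suml.
apply: big_ind => [|u w|i _]; [exact: in_frac0|exact: in_fracD|].
rewrite -mulrA; apply: in_fracM; first exact: tofrac_in_frac.
by have /vle1P := xA i; apply.
Qed.

(** One factor is replaced at a time. If [x] is in the inverse of [pmul A' B'], then for each [b']
    in [B'] the product [x * b'] is in the inverse of [A'], hence of [A]; so for each [a] in [A] the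
    product [x * a] is in the inverse of [B'], hence of [B]. *)
Lemma pmul_vle A B A' B' :
  vle A A' -> vle B B' -> vle (pmul A B) (pmul A' B').
Proof.
move=> AA' BB' x xAB' _ [a Aa [b Bb <-]].
rewrite mulrA; apply: (BB' (x * a)) Bb => b' B'b'.
rewrite mulrAC; apply: (AA' (x * b')) Aa => a' A'a'.
by rewrite mulrAC -mulrA; apply: xAB'; exists a' => //; exists b'.
Qed.

Lemma pow_vle A B n : vle A B -> vle (pow A n) (pow B n).
Proof. by move=> AB; elim: n => //= n IH; apply: pmul_vle. Qed.

Lemma pmulCA A B C : pmul A (pmul B C) `<=` pmul B (pmul A C).
Proof.
move=> _ [a Aa [_ [b Bb [c Cc <-]] <-]]; exists b => //.
by exists (a * c); [exists a => //; exists c|rewrite mulrCA].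
Qed.

(** A product of [n.+1] factors either has a factor in [B], which can be moved to the front, or has
    all its factors in [A]. *)
Lemma powU A B n :
  pow (A `|` B) n.+1 `<=` pmul B (pow (A `|` B) n) `|` pow A n.+1.
Proof.
elim: n => [|n IH] _ [x [Ax|Bx] [p Pp <-]]; last 1 first.
- by left; exists x => //; exists p.
- by right; exists x => //; exists p.
- by left; exists x => //; exists p.
case: (IH _ Pp) => [Bp|Ap].
  by left; apply: pmulCA; exists x; [left|exists p].
by right; exists x => //; exists p.
Qed.

(** By [powU], only products of elements of [A] need testing; when [A] is a single element [x], this
    is the one power [x ^+ n.+1]. *)
Lemma vred_sub A B n : vle (pow A n.+1) (pmul B (pow (A `|` B) n)) ->
  vred B (A `|` B) n.
Proof.
move=> AB; apply: vle_trans (sub_vle (@powU A B n)) _.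
exact: vleU.
Qed.

Lemma vred_vle A A' B B' n :
  vle A A' -> vle B B' -> vle B' B -> vred A B n -> vred A' B' n.
Proof.
move=> AA' BB' B'B AB; apply: vle_trans (pow_vle B'B) _.
apply: vle_trans AB _; apply: pmul_vle => //; exact: pow_vle.
Qed.

(** * Finite sequences of generators and the ideals they span *)

Lemma sub_in_frac I J : I `<=` J -> in_frac I `<=` in_frac J.
Proof. exact: image_subset. Qed.

(** Only the generators, not their span: by [vle_span] and [seq_frac_span] the two are
    v-equivalent. *)
Definition seq_frac s : set F := in_frac [set` s].

Lemma seq_frac_cat s k : seq_frac (s ++ k) = seq_frac s `|` seq_frac k.
Proof.
rewrite -[RHS]image_setU; congr (_ @` _); apply/seteqP; split=> x /=.
  by rewrite mem_cat => /orP.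
by move=> /orP; rewrite -mem_cat.
Qed.

Lemma ideal_span_ideal s : is_ideal (ideal_span s).
Proof.
split=> [|_ _ [f ->] [g ->]|r _ [f ->]].
- by exists (fun=> 0); rewrite big1 // => i _; rewrite mul0r.
- exists (fun i => f i + g i); rewrite -big_split /=.
  by apply: eq_bigr => i _; rewrite mulrDl.
- exists (fun i => r * f i); rewrite mulr_sumr.
  by apply: eq_bigr => i _; rewrite mulrA.
Qed.

Lemma mem_ideal_span s : [set` s] `<=` ideal_span s.
Proof.
move=> x /= xs; have lt_is : (index x s < size s)%N by rewrite index_mem.
exists (fun i => (i == Ordinal lt_is)%:R).
rewrite (bigD1 (Ordinal lt_is)) //= eqxx mul1r nth_index // big1 ?addr0 // => i.
by move/negPf->; rewrite mul0r.
Qed.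

Lemma ideal_sum I n (a : 'I_n -> R) :
  is_ideal I -> (forall i, I (a i)) -> I (\sum_i a i).
Proof. by move=> [I0 ID _] aI; apply: big_ind. Qed.

Lemma ideal_span_sub s I : is_ideal I -> [set` s] `<=` I -> ideal_span s `<=` I.
Proof.
move=> idI sI _ [f ->]; apply: ideal_sum => // i.
by case: (idI) => _ _; apply; apply: sI; rewrite /= mem_nth.
Qed.

Lemma vle_span s : vle (in_frac (ideal_span s)) (seq_frac s).
Proof.
apply: vle_bigcup => _ [_ [f ->] <-]; rewrite raddf_sum /=.
under eq_bigr => i _ do rewrite rmorphM.
apply: vle1_sum => i; apply: sub_vle => _ ->.
by exists s`_i => //=; rewrite mem_nth.
Qed.

Lemma seq_frac_span s : seq_frac s `<=` in_frac (ideal_span s).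
Proof. exact/sub_in_frac/mem_ideal_span. Qed.

Lemma nonzero_span s k : [set` s] `<=` [set` k] ->
  nonzero_ideal (ideal_span s) -> nonzero_ideal (ideal_span k).
Proof.
move=> sk [_ [x sx x0]]; split; first exact: ideal_span_ideal.
exists x => //; apply: ideal_span_sub sx; first exact: ideal_span_ideal.
exact: subset_trans (@mem_ideal_span k).
Qed.

Lemma nonzero_span_mem s x : x \in s -> x != 0 -> nonzero_ideal (ideal_span s).
Proof.
move=> xs x0; split; first exact: ideal_span_ideal.
by exists x => //; apply: mem_ideal_span.
Qed.

Lemma ideal_adjoin_span s x :
  ideal_adjoin (ideal_span s) x = ideal_span (x :: s).
Proof.
apply/seteqP; split=> [_ [a sa [r ->]]|].
  have [_ ID IM] := ideal_span_ideal (x :: s).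
  apply: ID; last by rewrite mulrC; apply/IM/mem_ideal_span; rewrite /= inE eqxx.
  apply: (ideal_span_sub (ideal_span_ideal _)) sa => y /= ys.
  by apply: mem_ideal_span; rewrite /= inE ys orbT.
move=> _ [f ->]; rewrite big_ord_recl /= addrC mulrC.
by exists (\sum_i f (lift ord0 i) * s`_i); [exists (f \o lift ord0)|exists (f ord0)].
Qed.

(** * Products and powers of ideals up to v-equivalence *)

Lemma ideal_mul_ideal I J : is_ideal I -> is_ideal (ideal_mul I J).
Proof.
move=> [I0 ID IM]; split.
- exists 0%N, (fun=> 0), (fun=> 0); split; [by case|by case|by rewrite big_ord0].
- move=> _ _ [n [a [b [aI bJ ->]]]] [m [c [d [cI dJ ->]]]].
  exists (n + m)%N, (fun i => match split i with inl i => a i | inr i => c i end).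
  exists (fun i => match split i with inl i => b i | inr i => d i end).
  split=> [i|i|]; [by case: split|by case: split|].
  rewrite big_split_ord /=; congr (_ + _); apply: eq_bigr => i _.
    by rewrite (unsplitK (inl i)).
  by rewrite (unsplitK (inr i)).
- move=> r _ [n [a [b [aI bJ ->]]]]; exists n, (fun i => r * a i), b.
  split=> // [i|]; first exact: IM.
  by rewrite mulr_sumr; apply: eq_bigr => i _; rewrite mulrA.
Qed.

Lemma mem_ideal_mul I J a b : I a -> J b -> ideal_mul I J (a * b).
Proof.
move=> Ia Jb; exists 1%N, (fun=> a), (fun=> b).
by split=> //; rewrite big_ord1.
Qed.

Lemma nonzero_ideal_mul I J :
  nonzero_ideal I -> nonzero_ideal J -> nonzero_ideal (ideal_mul I J).
Proof.
move=> [idI [a Ia a0]] [_ [b Jb b0]]; split; first exact: ideal_mul_ideal.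
by exists (a * b); [exact: mem_ideal_mul|rewrite mulf_neq0].
Qed.

Lemma nonzero_ideal_exp I n : nonzero_ideal I -> nonzero_ideal (ideal_exp I n).
Proof.
move=> I0; elim: n => [|n IH]; last exact: nonzero_ideal_mul.
by split=> //; exists 1; rewrite ?oner_neq0.
Qed.

Lemma vle_ideal_mul I J :
  vle (in_frac (ideal_mul I J)) (pmul (in_frac I) (in_frac J)).
Proof.
apply: vle_bigcup => _ [_ [n [a [b [aI bJ ->]]]] <-]; rewrite raddf_sum /=.
under eq_bigr => i _ do rewrite -[a i * b i]mul1r rmorphM.
apply: vle1_sum => i; apply: sub_vle => _ ->; rewrite rmorphM.
by exists (tofrac (a i)); [exists (a i)|exists (tofrac (b i)) => //; exists (b i)].
Qed.

Lemma pmul_ideal_mul I J :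
  vle (pmul (in_frac I) (in_frac J)) (in_frac (ideal_mul I J)).
Proof.
apply: sub_vle => _ [_ [a Ia <-] [_ [b Jb <-] <-]].
by exists (a * b); [exact: mem_ideal_mul|rewrite rmorphM].
Qed.

Lemma vle_ideal_exp I n : vle (in_frac (ideal_exp I n)) (pow (in_frac I) n).
Proof.
elim: n => [|n IH]; last exact: vle_trans (@vle_ideal_mul _ _) (pmul_vle _ IH).
(* At exponent zero the whole ring is compared with [[set 1]]: if [x * 1] is in the ring, so is
   [x * r]. *)
by move=> x x1 _ [r _ <-]; rewrite -[tofrac r]mul1r mulrA;
  apply: in_fracM; [apply: x1|exists r].
Qed.

Lemma pow_ideal_exp I n : vle (pow (in_frac I) n) (in_frac (ideal_exp I n)).
Proof.
elim: n => [|n IH]; last exact: vle_trans (pmul_vle _ IH) (@pmul_ideal_mul _ _).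
by apply: sub_vle => _ ->; exists 1; rewrite ?tofrac1.
Qed.

(** Products of ideals and products of their underlying sets are v-equivalent, so the test moves
    freely between them. *)
Lemma vredP J I n : vred (in_frac J) (in_frac I) n <->
  vle (in_frac (ideal_exp I n.+1)) (in_frac (ideal_mul J (ideal_exp I n))).
Proof.
have e1 := pmul_vle (@vle_refl (in_frac J)) (@vle_ideal_exp I n).
have e2 := pmul_vle (@vle_refl (in_frac J)) (@pow_ideal_exp I n).
split=> h.
  apply: vle_trans (@vle_ideal_exp _ _) _; apply: vle_trans h _.
  exact: vle_trans e2 (@pmul_ideal_mul _ _).
apply: vle_trans (@pow_ideal_exp _ _) _; apply: vle_trans h _.
exact: vle_trans (@vle_ideal_mul _ _) e1.
Qed.

Lemma ideal_mul_sub I J K : I `<=` J -> ideal_mul I K `<=` ideal_mul J K.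
Proof.
move=> IJ _ [n [a [b [aI bK ->]]]]; exists n, a, b; split=> // i; exact: IJ.
Qed.

Lemma v_reductionP J I : nonzero_ideal J -> nonzero_ideal I -> J `<=` I ->
  star_reduction (@v_op R) J I <-> exists n, vred (in_frac J) (in_frac I) n.
Proof.
move=> J0 I0 JI; split=> [[_ _ _ [n /v_op_eqP[_ h]]]|[n h]].
  by exists n; apply/vredP.
split=> //; exists n; apply/v_op_eqP; split; last exact/vredP.
(* The remaining half comes from the inclusion of [J] in [I], since [ideal_exp I n.+1] unfolds to
   [ideal_mul I (ideal_exp I n)]. *)
exact/sub_vle/sub_in_frac/ideal_mul_sub.
Qed.

(** * The t-closure through finite sequences in the ring *)

Lemma set_seq1E (T : eqType) (x : T) : [set` [:: x]] = [set x].
Proof.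
apply/seteqP; split=> y /=; first by rewrite inE => /eqP.
by move=> ->; rewrite mem_head.
Qed.

Lemma mem_frac_span (u : seq F) : [set` u] `<=` frac_span u.
Proof.
move=> x /= xu; have lt_iu : (index x u < size u)%N by rewrite index_mem.
exists (fun i => (i == Ordinal lt_iu)%:R).
rewrite (bigD1 (Ordinal lt_iu)) //= eqxx tofrac1 mul1r nth_index //.
by rewrite big1 ?addr0 // => i /negPf->; rewrite tofrac0 mul0r.
Qed.

Lemma frac_span_sub (u : seq F) I : is_ideal I ->
  [set` u] `<=` in_frac I -> frac_span u `<=` in_frac I.
Proof.
move=> [I0 ID IM] uI _ [r ->]; apply: big_ind => [|_ _ [a Ia <-] [b Ib <-]|i _].
- by exists 0; rewrite ?tofrac0.
- by exists (a + b); [exact: ID|rewrite tofracD].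
- have [|b Ib <-] := uI u`_i; first by rewrite /= mem_nth.
  by exists (r i * b); [exact: IM|rewrite tofracM].
Qed.

Lemma vle_frac_span (u : seq F) : vle (frac_span u) [set` u].
Proof.
apply: vle_bigcup => _ [r ->]; apply: vle1_sum => i.
by apply: sub_vle => _ ->; rewrite /= mem_nth.
Qed.

Lemma seq_frac_map s : seq_frac s = [set` map (@tofrac R) s].
Proof.
apply/seteqP; split=> [_ [a /= sa <-]|_ /= /mapP[a sa ->]]; first exact: map_f.
by exists a.
Qed.

Lemma sub_in_frac_seq (u : seq F) I : [set` u] `<=` in_frac I ->
  exists2 s, [set` s] `<=` I & u = map (@tofrac R) s.
Proof.
elim: u => [|y u IH] uI; first by exists [::].
have [|s sI ->] := IH.
  by move=> z /= zu; apply: uI; rewrite /= inE zu orbT.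
have [b Ib <-] := uI y (mem_head _ _).
by exists (b :: s) => // z; rewrite /= inE => /predU1P[->|/sI].
Qed.

(** A finitely generated submodule of [I] has its generators in [I], so the witness for [t_op] can
    be taken in the ring and replaced by a bare sequence; such witnesses can then be
    concatenated. *)
Lemma t_opP I x : nonzero_ideal I ->
  t_op (in_frac I) x <-> exists2 s, [set` s] `<=` I & vle [set x] (seq_frac s).
Proof.
move=> [idI [a Ia a0]]; split=> [[u [uI _ ux]]|[s sI sx]].
  have [s sI us] := sub_in_frac_seq (subset_trans (@mem_frac_span u) uI).
  exists s => //; rewrite seq_frac_map -us.
  by apply: vle_trans (@vle_frac_span u); apply/vle1P.
(* The nonzero [a] is prepended because [t_op] asks for a nonzero submodule, while [s] may be
   empty. *)
exists (map (@tofrac R) (a :: s)); split.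
- apply: frac_span_sub => //; rewrite -seq_frac_map; apply: sub_in_frac => y.
  by rewrite /= inE => /predU1P[->|/sI].
- exists (tofrac a); last by rewrite tofrac_eq0.
  by apply: mem_frac_span; rewrite /= mem_head.
- apply/vle1P; apply: vle_trans sx _; apply/sub_vle.
  rewrite seq_frac_map; apply: subset_trans (@mem_frac_span _) => y /= ys.
  by rewrite inE ys orbT.
Qed.

(** The single sequence [s] is a witness for every element of the v-closure. *)
Lemma t_op_v I s : nonzero_ideal I -> [set` s] `<=` I ->
  vle (in_frac I) (seq_frac s) -> t_op (in_frac I) = v_op (in_frac I).
Proof.
move=> I0 sI Is; apply/seteqP; split=> x.
  move=> /(t_opP _ I0)[k kI xk]; apply/vle1P/(vle_trans xk).
  exact/sub_vle/sub_in_frac.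
by move=> /vle1P xI; apply/t_opP => //; exists s => //; apply: vle_trans Is.
Qed.

Lemma t_op_mono I J : nonzero_ideal I -> nonzero_ideal J -> I `<=` J ->
  t_op (in_frac I) `<=` t_op (in_frac J).
Proof.
move=> I0 J0 IJ x /(t_opP _ I0)[s sI xs]; apply/t_opP => //.
by exists s => //; apply: subset_trans IJ.
Qed.

(** * Generators of products and powers; agreement of t and v in the finitely generated case *)

Definition mul_seq k l : seq R := [seq a * b | a <- k, b <- l].
Definition exp_seq l n : seq R := iter n (mul_seq l) [:: 1].

Lemma seq_frac_mul k l : seq_frac (mul_seq k l) = pmul (seq_frac k) (seq_frac l).
Proof.
apply/seteqP; split=> [_ [_ /allpairsP[[a b] /= [ka lb ->]] <-]|].
  by exists (tofrac a); [exists a|exists (tofrac b); [exists b|rewrite tofracM]].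
move=> _ [_ [a ka <-] [_ [b lb <-] <-]]; exists (a * b); last by rewrite tofracM.
exact: allpairs_f.
Qed.

Lemma seq_frac_exp l n : seq_frac (exp_seq l n) = pow (seq_frac l) n.
Proof.
elim: n => [|n IH]; last by rewrite /= seq_frac_mul IH.
by rewrite seq_frac_map /= tofrac1 set_seq1E.
Qed.

Lemma mul_seq_sub k l I J : [set` k] `<=` I -> [set` l] `<=` J ->
  [set` mul_seq k l] `<=` ideal_mul I J.
Proof.
move=> kI lJ x /= /allpairsP[[a b] /= [ka lb ->]].
by apply: mem_ideal_mul; [exact: kI|exact: lJ].
Qed.

Lemma exp_seq_sub l I n : [set` l] `<=` I -> [set` exp_seq l n] `<=` ideal_exp I n.
Proof. by move=> lI; elim: n => //= n IH; apply: mul_seq_sub. Qed.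

(** Both ideals compared in a reduction are v-equivalent to finite sequences of their own elements,
    products of generators, so [t_op_v] applies to each. *)
Lemma fg_v_reduction_t J I : nonzero_ideal J -> nonzero_ideal I -> J `<=` I ->
  fg_ideal J -> fg_ideal I ->
  star_reduction (@t_op R) J I <-> star_reduction (@v_op R) J I.
Proof.
move=> J0 I0 JI [k Jk] [l Il].
have kJ : [set` k] `<=` J by rewrite Jk; apply: mem_ideal_span.
have lI : [set` l] `<=` I by rewrite Il; apply: mem_ideal_span.
have expE n : vle (in_frac (ideal_exp I n)) (pow (seq_frac l) n).
  apply: vle_trans (@vle_ideal_exp _ _) _; apply: pow_vle; rewrite Il.
  exact: vle_span.
have tE n : t_op (in_frac (ideal_exp I n)) = v_op (in_frac (ideal_exp I n)).
  apply: (@t_op_v _ (exp_seq l n)); rewrite ?seq_frac_exp //.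
  - exact: nonzero_ideal_exp.
  - exact: exp_seq_sub.
have tmE n : t_op (in_frac (ideal_mul J (ideal_exp I n)))
           = v_op (in_frac (ideal_mul J (ideal_exp I n))).
  apply: (@t_op_v _ (mul_seq k (exp_seq l n))).
  - by apply: nonzero_ideal_mul => //; exact: nonzero_ideal_exp.
  - by apply: mul_seq_sub => //; exact: exp_seq_sub.
  - rewrite seq_frac_mul seq_frac_exp; apply: vle_trans (@vle_ideal_mul _ _) _.
    by apply: pmul_vle => //; rewrite Jk; apply: vle_span.
by split=> -[_ _ _ [n h]]; split=> //; exists n; move: h; rewrite tmE tE.
Qed.

Lemma vred_seq_reduction k l n :
  nonzero_ideal (ideal_span k) -> [set` k] `<=` [set` l] ->
  vred (seq_frac k) (seq_frac l) n ->
  star_reduction (@v_op R) (ideal_span k) (ideal_span l).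
Proof.
move=> k0 kl h; have l0 := nonzero_span kl k0.
apply/v_reductionP => //.
  apply: ideal_span_sub (ideal_span_ideal _) _.
  exact: subset_trans (@mem_ideal_span l).
exists n; apply: vred_vle h; last exact: vle_span.
- exact/sub_vle/seq_frac_span.
- exact/sub_vle/seq_frac_span.
Qed.

Lemma vred_seq_t_reduction k l n :
  nonzero_ideal (ideal_span k) -> [set` k] `<=` [set` l] ->
  vred (seq_frac k) (seq_frac l) n ->
  star_reduction (@t_op R) (ideal_span k) (ideal_span l).
Proof.
move=> k0 kl h; have hv := vred_seq_reduction k0 kl h.
by case: (hv) => k1 l1 kl1 _; apply/fg_v_reduction_t => //; [exists k|exists l].
Qed.

Lemma vle_t_op_span s x : nonzero_ideal (ideal_span s) ->
  t_op (in_frac (ideal_span s)) x -> vle [set x] (seq_frac s).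
Proof.
move=> s0 /(t_opP _ s0)[k ks xk]; apply: vle_trans xk _.
apply: vle_trans (@vle_span s); exact/sub_vle/sub_in_frac.
Qed.

(** * Finite support of t-reductions *)

Lemma sub_t_op I : nonzero_ideal I -> in_frac I `<=` t_op (in_frac I).
Proof.
move=> I0 _ [a Ia <-]; apply/t_opP => //; exists [:: a].
  by move=> x /=; rewrite inE => /eqP->.
by apply: sub_vle => _ ->; exists a => //=; rewrite mem_head.
Qed.

(** Each entry of [s] has its own finite witness in [I], and the concatenation serves all of
    them. *)
Lemma t_op_seq I s : nonzero_ideal I -> seq_frac s `<=` t_op (in_frac I) ->
  exists2 u, [set` u] `<=` I & vle (seq_frac s) (seq_frac u).
Proof.
move=> I0; elim: s => [|a s IH] sI.
  by exists [::]; [|apply: sub_vle].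
have [|u uI su] := IH.
  apply: subset_trans sI; apply: sub_in_frac => x /= xs.
  by rewrite inE xs orbT.
have [|v vI av] := proj1 (t_opP (tofrac a) I0).
  by apply: sI; exists a => //=; rewrite mem_head.
exists (u ++ v) => [x /=|]; first by rewrite mem_cat => /orP[/uI|/vI].
rewrite -cat1s !seq_frac_cat; apply: vleU.
  rewrite seq_frac_map /= set_seq1E; apply: vle_trans av _; exact: sub_vle.
by apply: vle_trans su _; apply: sub_vle.
Qed.

(** Each of the finitely many summands [a i * b i] contributes [a i] and a support of [b i]. The
    hypothesis on [J] is kept abstract so that the lemma serves the induction on the exponent as
    well as the final product. *)
Lemma ideal_mul_support I J I' n x :
  (forall b, J b ->
    exists2 l, [set` l] `<=` I' & vle [set tofrac b] (pow (seq_frac l) n)) ->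
  ideal_mul I J x -> exists k l, [/\ [set` k] `<=` I, [set` l] `<=` I'
    & vle [set tofrac x] (pmul (seq_frac k) (pow (seq_frac l) n))].
Proof.
move=> HJ [m [a [b [aI bJ ->]]]].
have /choice[f fP] : forall i, exists l, [set` l] `<=` I' /\
    vle [set tofrac (b i)] (pow (seq_frac l) n).
  by move=> i; have [l lI bl] := HJ _ (bJ i); exists l.
exists [seq a i | i <- enum 'I_m], (flatten [seq f i | i <- enum 'I_m]); split.
- by move=> _ /= /mapP[i _ ->].
- by move=> y /= /flatten_mapP[i _]; have [fI _] := fP i; apply: fI.
rewrite raddf_sum /=; under eq_bigr => i _ do rewrite -[a i * b i]mul1r rmorphM.
apply: vle1_sum => i; rewrite rmorphM.
apply: (@vle_trans (pmul [set tofrac (a i)] [set tofrac (b i)])).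
  by apply: sub_vle => _ ->; exists (tofrac (a i)) => //; exists (tofrac (b i)).
apply: pmul_vle.
  by apply: sub_vle => _ ->; exists (a i) => //=; rewrite map_f ?mem_enum.
have [_ h] := fP i; apply: vle_trans h _; apply/pow_vle/sub_vle/sub_in_frac.
by move=> y /= yf; apply/flatten_mapP; exists i; rewrite ?mem_enum.
Qed.

Lemma ideal_exp_support I n x : ideal_exp I n x ->
  exists2 l, [set` l] `<=` I & vle [set tofrac x] (pow (seq_frac l) n).
Proof.
elim: n x => [|n IH] x xI.
  exists [::] => //; apply: vle_trans (@vle_ideal_exp I 0).
  by apply: sub_vle => _ ->; exists x.
have [k [l [kI lI xkl]]] := ideal_mul_support IH xI.
exists (k ++ l) => [y /=|]; first by rewrite mem_cat => /orP[/kI|/lI].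
apply: vle_trans xkl _; rewrite seq_frac_cat.
by apply: pmul_vle; [|apply: pow_vle]; apply: sub_vle.
Qed.

Lemma ideal_mul_exp_support I J n u : [set` u] `<=` ideal_mul J (ideal_exp I n) ->
  exists k l, [/\ [set` k] `<=` J, [set` l] `<=` I
    & vle (seq_frac u) (pmul (seq_frac k) (pow (seq_frac l) n))].
Proof.
elim: u => [|x u IH] uI.
  by exists [::], [::]; split=> //; apply: sub_vle => y [].
have [|k [l [kJ lI ukl]]] := IH.
  by move=> y /= yu; apply: uI; rewrite /= inE yu orbT.
have [k' [l' [k'J l'I xkl]]] :=
  ideal_mul_support (@ideal_exp_support I n) (uI x (mem_head _ _)).
exists (k ++ k'), (l ++ l'); split=> [y /=|y /=|].
- by rewrite mem_cat => /orP[/kJ|/k'J].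
- by rewrite mem_cat => /orP[/lI|/l'I].
rewrite -cat1s !seq_frac_cat; apply: vleU.
  rewrite seq_frac_map /= set_seq1E; apply: vle_trans xkl _.
  by apply: pmul_vle; [|apply: pow_vle]; apply: sub_vle.
apply: vle_trans ukl _.
by apply: pmul_vle; [|apply: pow_vle]; apply: sub_vle.
Qed.

(** The entries of [s] lie in the t-closure of [J I^n], so finitely many elements of [J I^n]
    dominate them, and these involve only finitely many elements of [J] and of [I]. *)
Lemma t_reduction_support J I n s : nonzero_ideal J -> nonzero_ideal I ->
  t_op (in_frac (ideal_mul J (ideal_exp I n))) = t_op (in_frac (ideal_exp I n.+1)) ->
  [set` s] `<=` ideal_exp I n.+1 ->
  exists k l, [/\ [set` k] `<=` J, [set` l] `<=` I
    & vle (seq_frac s) (pmul (seq_frac k) (pow (seq_frac l) n))].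
Proof.
move=> J0 I0 JI sI.
have JI0 : nonzero_ideal (ideal_mul J (ideal_exp I n)).
  by apply: nonzero_ideal_mul => //; apply: nonzero_ideal_exp.
have [|u uJI su] := @t_op_seq _ s JI0.
  rewrite JI; apply: subset_trans (@sub_t_op _ _); first exact: sub_in_frac.
  exact: nonzero_ideal_exp.
have [k [l [kJ lI ukl]]] := ideal_mul_exp_support uJI.
by exists k, l; split=> //; apply: vle_trans ukl.
Qed.

(** * Dropping adjoined generators one at a time *)

Lemma vred_seq_vle k l n :
  (forall I, nonzero_ideal I -> fg_ideal I ->
    t_op (in_frac I) = in_frac (t_hat I)) ->
  nonzero_ideal (ideal_span k) -> vred (seq_frac k) (seq_frac (k ++ l)) n ->
  vle (seq_frac (k ++ l)) (seq_frac k).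
Proof.
move=> hat k0; elim: l => [|a l IH] h; first by rewrite cats0.
have k'0 : nonzero_ideal (ideal_span (k ++ l)).
  by apply: nonzero_span k0 => x /= xk; rewrite mem_cat xk.
have alE : seq_frac (k ++ a :: l) = seq_frac (a :: k ++ l).
  congr (_ @` _); apply/seteqP; split=> x /=; rewrite !(inE, mem_cat);
  by rewrite orbCA.
have kl : vle (seq_frac k) (seq_frac (k ++ l)).
  by rewrite seq_frac_cat; apply: sub_vle.
have akl : vle (seq_frac (a :: k ++ l)) (seq_frac (k ++ l)).
  rewrite -cat1s seq_frac_cat; apply: vleU => //.
  rewrite seq_frac_map /= set_seq1E; apply: vle_t_op_span => //.
  (* By [hat], it suffices that [k ++ l] reduces [a :: k ++ l], which holds because the smaller [k]
     already does. *)
  rewrite hat //; last by exists (k ++ l).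
  exists a => //; rewrite /t_hat /= ideal_adjoin_span.
  apply: (@vred_seq_t_reduction _ _ n) => //.
    by move=> x /= xkl; rewrite inE xkl orbT.
  by rewrite -alE; apply: vred_vle h.
(* As [a :: k ++ l] and [k ++ l] are now v-equivalent, [k] reduces [k ++ l] with the same
   exponent. *)
rewrite alE; apply: (vle_trans akl); apply: IH; apply: vred_vle h => //.
  by rewrite alE.
by rewrite alE; apply/sub_vle/sub_in_frac => x /= xkl; rewrite inE xkl orbT.
Qed.

(** Each entry of [l] has the form [a + x * r]; the finitely many [a] are collected in [k]. *)
Lemma ideal_adjoin_support I x l : is_ideal I -> [set` l] `<=` ideal_adjoin I x ->
  exists2 k, [set` k] `<=` I & [set` l] `<=` ideal_span (x :: k).
Proof.
move=> idI; elim: l => [|y l IH] lI; first by exists [::].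
have [|k kI lk] := IH.
  by move=> z /= zl; apply: lI; rewrite /= inE zl orbT.
have [a Ia [r ya]] := lI y (mem_head _ _).
exists (a :: k) => [z /=|z /=]; first by rewrite inE => /predU1P[->|/kI].
have [_ D M] := ideal_span_ideal [:: x, a & k].
rewrite inE => /predU1P[->|/lk].
  rewrite ya mulrC; apply: D; last apply: M.
    by apply: mem_ideal_span; rewrite /= !inE eqxx orbT.
  by apply: mem_ideal_span; rewrite /= !inE eqxx.
apply: ideal_span_sub; first exact: ideal_span_ideal.
move=> w /= wxk; apply: mem_ideal_span; rewrite /= !inE.
by move: wxk; rewrite inE => /predU1P[->|->]; rewrite ?eqxx ?orbT.
Qed.

(** * Scaling, and the passage from t-basic to v-basic *)

Lemma pow1 (x : F) n : pow [set x] n = [set x ^+ n].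
Proof.
elim: n => //= n ->; rewrite exprS; apply/seteqP; split.
  by move=> _ [_ -> [_ -> <-]].
by move=> _ ->; exists x => //; exists (x ^+ n).
Qed.

Lemma pow_pmul A B n : pow (pmul A B) n `<=` pmul (pow A n) (pow B n).
Proof.
elim: n => [_ ->|n IH _ [_ [a Aa [b Bb <-]] [p /IH[c Ac [d Bd <-]] <-]]].
  by exists 1 => //; exists 1; rewrite ?mul1r.
exists (a * c); first by exists a => //; exists c.
by exists (b * d); [exists b => //; exists d|rewrite mulrACA].
Qed.

Lemma pmul_pow1 (x : F) A n w : pow A n w -> pow (pmul [set x] A) n (x ^+ n * w).
Proof.
elim: n w => [|n IH] w; first by move=> ->; rewrite mulr1.
move=> [a Aa [v /IH Av <-]]; exists (x * a); first by exists x => //; exists a.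
by exists (x ^+ n * v); rewrite // exprS mulrACA.
Qed.

Lemma seq_frac_scale p s :
  seq_frac [seq p * x | x <- s] = pmul [set tofrac p] (seq_frac s).
Proof.
rewrite -(set_seq1E (tofrac p)) -[ [:: _] ]/(map (@tofrac R) [:: p]).
by rewrite -seq_frac_map -seq_frac_mul /mul_seq /= cats0.
Qed.

(* An element [p / q] of [frac_inv A] turns the v-reduction [A] of [s] into the
   principal, hence finitely generated, v-reduction [q] of [p s + q]. *)
Lemma principal_vred A s n p q : q != 0 ->
  frac_inv A (tofrac p / tofrac q) -> vred A (seq_frac s) n ->
  vred (seq_frac [:: q]) (seq_frac ([seq p * x | x <- s] ++ [:: q])) n.
Proof.
move=> q0 zJ Js; rewrite seq_frac_cat; apply: vred_sub.
apply: (@vle_trans (pmul (seq_frac [:: q])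
                         (pow (seq_frac [seq p * x | x <- s]) n))); last first.
  by apply: pmul_vle => //; apply/pow_vle/sub_vle.
rewrite seq_frac_scale => y yq v /pow_pmul[c]; rewrite pow1 => -> [w sw <-].
(* By [Js], it is enough that [y * tofrac p ^+ n.+1] multiplies [A s^n] into the ring. *)
rewrite mulrA; apply: Js sw => _ [j Jj [u su <-]].
rewrite exprS (@mul_rearrange _ (tofrac q)) ?tofrac_eq0 //.
apply: in_fracM; first exact: zJ.
apply: yq; exists (tofrac q); first by exists q => //=; rewrite mem_head.
by exists (tofrac p ^+ n * u) => //; apply: pmul_pow1.
Qed.

Lemma v_basic_of_t_basic :
  finite_star_basic_property (@t_op R) -> finite_star_basic_property (@v_op R).
Proof.
move=> tb I I0 [s Is] J JI; split=> //; case: (JI) => J0 _ sJI [n].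
move=> /v_op_eqP[_ /vredP h]; apply/v_op_eqP; split; first exact/sub_vle/sub_in_frac.
have {}h : vred (in_frac J) (seq_frac s) n.
  apply: vred_vle h; rewrite // Is; first exact: vle_span.
  exact/sub_vle/seq_frac_span.
suff sJ : vle (seq_frac s) (in_frac J).
  by apply: vle_trans sJ; rewrite Is; apply: vle_span.
move=> z zJ _ [x /= xs <-].
(* Any nonzero [q] in [J] is a denominator for [z], since [z J] is contained in the ring. *)
have [_ [q Jq q0]] := J0.
have q0' : tofrac q != 0 :> F by rewrite tofrac_eq0.
have [p _ pE] : in_frac [set: R] (z * tofrac q) by apply: zJ; exists q.
have zE : z = tofrac p / tofrac q by rewrite pE mulfK.
have qz : nonzero_ideal (ideal_span [:: q]).
  by apply: nonzero_span_mem q0; rewrite mem_head.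
have sub_q : [set` [:: q]] `<=` [set` [seq p * x | x <- s] ++ [:: q]].
  by move=> y /= yq; rewrite mem_cat yq orbT.
(* Scaling by [p] turns [I + (z^-1)] into [p I + (q)], which still makes sense when [z] is zero. *)
rewrite zE in zJ; have := vred_seq_t_reduction qz sub_q (principal_vred q0 zJ h).
move=> red; have [_ sq _ _] := red.
have [|_ tE] := tb _ sq _ _ red; first by exists ([seq p * x | x <- s] ++ [:: q]).
have : vle [set tofrac (p * x)] (seq_frac [:: q]).
  apply: vle_t_op_span => //; rewrite tE; apply: sub_t_op => //.
  exists (p * x) => //; apply: mem_ideal_span; rewrite /= mem_cat.
  by rewrite (map_f (fun x => p * x)).
(* Testing on the inverse of [q] turns membership of [p * x] in the closure of [(q)] into
   integrality of [z * x]. *)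
move=> /(_ (tofrac q)^-1) pxq.
have -> : z * tofrac x = (tofrac q)^-1 * tofrac (p * x).
  by rewrite zE tofracM mulrA [_^-1 * _]mulrC.
apply: pxq => //.
by rewrite seq_frac_map /= set_seq1E => _ ->; rewrite mulVf //; exists 1; rewrite ?tofrac1.
Qed.

(** * From the hat condition to the finite t-basic property *)

Lemma t_basic_of_t_hat :
  (forall I, nonzero_ideal I -> fg_ideal I ->
    t_op (in_frac I) = in_frac (t_hat I)) ->
  finite_star_basic_property (@t_op R).
Proof.
move=> hat I I0 [s Is] J JI; split=> //; case: (JI) => J0 _ sJI [n JIE].
have sI : [set` s] `<=` I by rewrite Is; apply: mem_ideal_span.
have vIs : vle (in_frac I) (seq_frac s) by rewrite Is; apply: vle_span.
have [k [l [kJ lI]]] := t_reduction_support J0 I0 JIE (exp_seq_sub (n := n.+1) sI).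
rewrite seq_frac_exp => skl.
(* Prepending a nonzero [j] makes the span a nonzero ideal even if [k] is empty. *)
have [_ [j Jj j0]] := J0.
have j1 : nonzero_ideal (ideal_span (j :: k)).
  by apply: nonzero_span_mem j0; rewrite mem_head.
have jkJ : [set` j :: k] `<=` J by move=> y /=; rewrite inE => /predU1P[->|/kJ].
have jks : vle (seq_frac (j :: k)) (seq_frac s).
  by apply: vle_trans vIs; apply/sub_vle/sub_in_frac/(subset_trans jkJ).
(* [vred_seq_vle] wants the reducing sequence as a prefix of the reduced one; [(j :: k) ++ s] is
   v-equivalent to [s] and has this shape. *)
have s_jks : vle (seq_frac s) (seq_frac ((j :: k) ++ s)).
  by rewrite seq_frac_cat; apply: sub_vle.
have jks_s : vle (seq_frac ((j :: k) ++ s)) (seq_frac s).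
  by rewrite seq_frac_cat; apply: vleU.
have h : vred (seq_frac (j :: k)) (seq_frac ((j :: k) ++ s)) n.
  apply: (@vred_vle (seq_frac (j :: k)) _ (seq_frac s)) => //.
  apply: vle_trans skl _; apply: pmul_vle.
    by rewrite -cat1s seq_frac_cat; apply: sub_vle.
  apply: pow_vle; apply: vle_trans vIs; exact/sub_vle/sub_in_frac.
have jk := vle_trans s_jks (vred_seq_vle hat j1 h).
apply/seteqP; split; first exact: t_op_mono.
move=> x /(t_opP _ I0)[u uI xu]; apply/t_opP => //; exists (j :: k) => //.
apply: vle_trans xu _; apply: vle_trans jk; apply: vle_trans vIs.
exact/sub_vle/sub_in_frac.
Qed.

(** * From the finite v-basic property to the hat condition *)

Lemma t_hat_of_v_basic I :
  finite_star_basic_property (@v_op R) -> nonzero_ideal I ->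
  t_op (in_frac I) = in_frac (t_hat I).
Proof.
move=> vb I0; have [idI [a0 Ia0 a0_neq0]] := I0.
apply/seteqP; split=> y.
  move=> Iy; have [s sI ys] := proj1 (t_opP _ I0) Iy.
  (* Since [1] multiplies the entries of [s] into the ring, it does the same to [y], so [y] comes
     from some [x]. *)
  have [x _ xE] : in_frac [set: R] y.
    rewrite -[y]mul1r; apply: (ys 1) => //.
    by move=> _ [b _ <-]; rewrite mul1r; exists b.
  have xs : vle [set tofrac x] (seq_frac s) by rewrite xE.
  have IsubL : I `<=` ideal_adjoin I x.
    by move=> b Ib; exists b => //; exists 0; rewrite mulr0 addr0.
  have L0 : nonzero_ideal (ideal_adjoin I x).
    have [Iz ID IM] := idI.
    split; last by exists a0 => //; apply: IsubL.
    split.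
    - exact: IsubL.
    - move=> _ _ [b Ib [r ->]] [c Ic [t ->]]; exists (b + c); first exact: ID.
      by exists (r + t); rewrite mulrDr addrACA.
    - move=> t _ [b Ib [r ->]]; exists (t * b); first exact: IM.
      by exists (t * r); rewrite mulrDr mulrCA.
  (* Exponent zero is enough, because adjoining an element of the t-closure does not change the
     t-closure. *)
  exists x => //; split=> //; exists 0%N; rewrite /=.
  have mul1 J : nonzero_ideal J -> ideal_mul J [set: R] = J.
    move=> [idJ _]; apply/seteqP; split=> [_ [n [b [c [bJ _ ->]]]]|b Jb].
      apply: ideal_sum => // i; rewrite mulrC; by case: idJ => _ _; apply.
    by rewrite -[b]mulr1; apply: mem_ideal_mul.
  rewrite /ideal_exp /= !mul1 //; apply/seteqP; split; first exact: t_op_mono.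
  move=> w /(t_opP _ L0)[u uL wu].
  have [k kI uk] := ideal_adjoin_support idI uL.
  (* [k] covers the part of [u] coming from [I], and [s] stands in for [x]. *)
  apply/t_opP => //; exists (k ++ s) => [b /=|].
    by rewrite mem_cat => /orP[/kI|/sI].
  apply: vle_trans wu _; apply: vle_trans (sub_vle (sub_in_frac uk)) _.
  apply: vle_trans (@vle_span _) _; rewrite -cat1s !seq_frac_cat; apply: vleU.
    rewrite seq_frac_map /= set_seq1E; apply: vle_trans xs _; exact: sub_vle.
  exact: sub_vle.
move=> [x [_ L0 IL [n JIE]] <-].
have Lx : ideal_adjoin I x x.
  by exists 0; [case: idI|exists 1; rewrite mulr1 add0r].
have xL : [set` [:: x]] `<=` ideal_adjoin I x by move=> z; rewrite set_seq1E => ->.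
have [k [l [kI lL]]] := t_reduction_support I0 L0 JIE (exp_seq_sub (n := n.+1) xL).
have [m mI lm] := ideal_adjoin_support idI lL.
rewrite seq_frac_exp => xkl.
(* [K] gathers all elements of [I] used in the bound on [x ^+ n.+1], together with a nonzero one. *)
pose K := a0 :: k ++ m.
have K0 : nonzero_ideal (ideal_span K).
  by apply: nonzero_span_mem a0_neq0; rewrite mem_head.
have KI : [set` K] `<=` I.
  by move=> b /=; rewrite inE mem_cat => /or3P[/eqP->|/kI|/mI].
have red : star_reduction (@v_op R) (ideal_span K) (ideal_span (x :: K)).
  apply: (@vred_seq_reduction _ _ n) => //.
    by move=> b /= bK; rewrite inE bK orbT.
  (* Only the power [x ^+ n.+1] has to be dominated, and [xkl] does so once [l] is replaced by
     [x :: m]. *)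
  rewrite -cat1s seq_frac_cat; apply: vred_sub; apply: vle_trans xkl _.
  apply: pmul_vle.
    apply/sub_vle/sub_in_frac => b /= bk; by rewrite inE mem_cat bk orbT.
  apply: pow_vle; apply: vle_trans (sub_vle (sub_in_frac lm)) _.
  apply: vle_trans (@vle_span _) _; rewrite -cat1s seq_frac_cat.
  apply: vleU; apply: sub_vle; first exact: subsetUl.
  apply: subset_trans (@subsetUr _ _ _); apply: sub_in_frac => b /= bm.
  by rewrite inE mem_cat bm !orbT.
have [_ xK0 _ _] := red.
have [|_ /v_op_eqP[_ xK]] := vb _ xK0 _ _ red; first by exists (x :: K).
(* Triviality of the reduction puts [x] in the v-closure of [K], a finite part of [I], hence in the
   t-closure of [I]. *)
apply/t_opP => //; exists K => //; apply: vle_trans (@vle_span _).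
apply: vle_trans xK; apply: sub_vle => _ ->; exists x => //.
by apply: mem_ideal_span; rewrite /= mem_head.
Qed.

End FractionSets.

Theorem theorem3p2 (R : idomainType) :
  [<-> (forall I : set R, nonzero_ideal I ->
          t_op (in_frac I) = in_frac (t_hat I));
       (forall I : set R, nonzero_ideal I -> fg_ideal I ->
          t_op (in_frac I) = in_frac (t_hat I));
       finite_star_basic_property (@t_op R);
       finite_star_basic_property (@v_op R)].
Proof.
tfae.
- by move=> hat I I0 _; apply: hat.
- exact: t_basic_of_t_hat.
- exact: v_basic_of_t_basic.
- by move=> vb I; apply: t_hat_of_v_basic.
Qed.
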